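(* Fix $\mu \in \mathcal{X}$ and let $P_X$ be a probability distribution on $\mathcal{X}$ with $P_X(\{ \mu \}) = 0$. Let $(P_n)$ be a sequence of probability distributions on $\mathcal{X}$ converging weakly to $P_X$. Then $D(\mu; P_n) \to D(\mu; P_X)$ as $n \to \infty$.
   Context: $(\mathcal{X}, d)$ is a complete separable metric space with its Borel $\sigma$-algebra. Define $h: \mathcal{X}^3 \to \mathbb{R}$ by $h(x_1, x_2, x_3) := \mathbb{I}( x_3 \notin \{x_1, x_2\} ) \dfrac{ d^2(x_1, x_3) + d^2(x_2, x_3) - d^2(x_1, x_2) }{d(x_1, x_3)\, d(x_2, x_3) }$, where $h := 0$ when $x_3 \in \{x_1,x_2\}$. The metric spatial depth of $\mu \in \mathcal{X}$ with respect to a probability distribution $P_X$ on $\mathcal{X}$ is $D(\mu; P_X) := 1 - \frac{1}{2} \mathrm{E} \{ h(X_1, X_2, \mu) \}$, where $X_1, X_2 \sim P_X$ are independent. *)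

(* Defs.v *)
From HB Require Import structures.
From mathcomp Require Import all_boot all_order all_algebra.
From mathcomp Require Import all_classical all_reals all_analysis.
Set Implicit Arguments. Unset Strict Implicit. Unset Printing Implicit Defensive.
Import Order.TTheory GRing.Theory Num.Theory.
Import numFieldNormedType.Exports.
Local Open Scope classical_set_scope.
Local Open Scope ring_scope.

Section MetricDefs.
Context {R : realType} {T : Type}.

Definition is_metric (dist : T -> T -> R) : Prop :=
  [/\ forall x y, 0 <= dist x y,
      forall x y, dist x y = 0 <-> x = y,
      forall x y, dist x y = dist y x &
      forall x y z, dist x z <= dist x y + dist y z].

Definition metric_complete (dist : T -> T -> R) : Prop :=
  forall u : nat -> T,
    (forall e : R, 0 < e -> exists N, forall m n, (N <= m)%N -> (N <= n)%N ->
        dist (u m) (u n) < e) ->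
    exists l, forall e : R, 0 < e -> exists N, forall n, (N <= n)%N -> dist (u n) l < e.

Definition metric_separable (dist : T -> T -> R) : Prop :=
  exists S : set T, countable S /\
    forall x (e : R), 0 < e -> exists2 s, S s & dist x s < e.

Definition metric_open (dist : T -> T -> R) (A : set T) : Prop :=
  forall x, A x -> exists2 r : R, 0 < r & [set y | dist x y < r] `<=` A.

Definition metric_continuous (dist : T -> T -> R) (f : T -> R) : Prop :=
  forall x (e : R), 0 < e -> exists2 del : R, 0 < del &
    forall y, dist x y < del -> `|f x - f y| < e.

End MetricDefs.

Definition hker {R : realType} {T : eqType} (dist : T -> T -> R) (x1 x2 x3 : T) : R :=
  if (x3 == x1) || (x3 == x2) then 0
  else (dist x1 x3 ^+ 2 + dist x2 x3 ^+ 2 - dist x1 x2 ^+ 2)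
       / (dist x1 x3 * dist x2 x3).

Definition msdepth {R : realType} {d} {T : measurableType d}
  (dist : T -> T -> R) (P : probability T R) (mu : T) : \bar R :=
  (1 - 2^-1%:E * \int[(P \x P)%E]_z (hker dist z.1 z.2 mu)%:E)%E.

Definition weak_cvg {R : realType} {d} {T : measurableType d}
  (dist : T -> T -> R) (Pn : nat -> probability T R) (P : probability T R) : Prop :=
  forall f : T -> R, metric_continuous dist f ->
    (exists M : R, forall x, `|f x| <= M) ->
    (fun n => \int[Pn n]_x (f x)%:E)%E @ \oo --> (\int[P]_x (f x)%:E)%E.

(* Main.v *)
(* The kernel h(x, y, mu) is bounded by 2 but discontinuous where x or y is mu.
   Writing h = 2 - (d(x, y)^2 - (d(x, mu) - d(y, mu))^2) / (d(x, mu) d(y, mu)) and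
   adding e to both factors of the denominator gives a bounded Lipschitz kernel g_e
   with |h - g_e| <= 4 (t(x) + t(y)), where
   t = e / (d(., mu) + e) is Lipschitz and has small P_X-mean for small e because
   P_X has no atom at mu. A Lipschitz partition of unity p_i subordinate to small
   balls around a dense sequence s_i gives g_e(x, y) ~ \sum_i p_i(x) g_e(s_i, y),
   with an error controlled by a continuous remainder of small P_X-mean. The double
   integral of such a sum is a sum of products of single integrals, which converge
   by weak convergence, and the means of the error bounds converge as well. *)
Require Import Defs.
From HB Require Import structures.
From mathcomp Require Import all_boot all_order all_algebra.
From mathcomp Require Import all_classical all_reals all_analysis.
From mathcomp Require Import measurable_realfun ring lra.
Set Implicit Arguments. Unset Strict Implicit. Unset Printing Implicit Defensive.
Import Order.TTheory GRing.Theory Num.Theory.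
Import numFieldNormedType.Exports.
Local Open Scope classical_set_scope.
Local Open Scope ring_scope.

(** * Inequalities for the kernel as a function of three distances *)

Section cosine_kernel.
Context {R : realFieldType}.
Implicit Types a b c e : R.

(* With [a = d(x, mu)], [b = d(y, mu)], [c = d(x, y)], the value at [e = 0] is
   the kernel [h(x, y, mu)] when [a] and [b] are nonzero; [e > 0] removes its singularity at [mu]. *)
Definition damped_kernel e a b c :=
  2 - (c ^+ 2 - (a - b) ^+ 2) / ((a + e) * (b + e)).

Lemma norm_damped_kernel_le2 e a b c : 0 <= e -> 0 <= a -> 0 <= b -> 0 <= c ->
  `|a - b| <= c -> c <= a + b -> `|damped_kernel e a b c| <= 2.
Proof.
move=> e0 a0 b0 c0; rewrite ler_norml => /andP[ab1 ab2] cab.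
rewrite ler_norml /damped_kernel; set D := (a + e) * (b + e).
have D0 : 0 <= D by rewrite mulr_ge0// addr_ge0.
have N0 : 0 <= c ^+ 2 - (a - b) ^+ 2 by nra.
have N4 : c ^+ 2 - (a - b) ^+ 2 <= 4 * D by rewrite /D; nra.
have q0 : 0 <= (c ^+ 2 - (a - b) ^+ 2) / D by rewrite divr_ge0.
have q4 : (c ^+ 2 - (a - b) ^+ 2) / D <= 4.
  have [->|Dn0] := eqVneq D 0; first by rewrite invr0 mulr0.
  by rewrite ler_pdivrMr// lt_neqAle eq_sym Dn0.
by apply/andP; split; lra.
Qed.

(** Put [s = e / (a + e)], [t = e / (b + e)] and [N = c ^+ 2 - (a - b) ^+ 2]. Damping multiplies
    [N / (a * b)], which is at most [4], by [(1 - s) * (1 - t)], so the loss is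
    [N / (a * b) * (s + t - s * t)]. *)
Lemma damped_kernel_approx e a b c : 0 < e -> 0 <= a -> 0 <= b -> 0 <= c ->
  `|a - b| <= c -> c <= a + b ->
  `|(a ^+ 2 + b ^+ 2 - c ^+ 2) / (a * b) - damped_kernel e a b c|
  <= 4 * (e / (a + e)) + 4 * (e / (b + e)).
Proof.
move=> e0 a0 b0 c0 abc cab.
have ae : 0 < a + e by rewrite ltr_wpDl.
have be : 0 < b + e by rewrite ltr_wpDl.
have ta : 0 <= e / (a + e) by rewrite divr_ge0 ?ltW.
have tb : 0 <= e / (b + e) by rewrite divr_ge0 ?ltW.
(* A vanishing distance makes the undamped term [0] by [x / 0 = 0], while one of the two damping
   terms equals [1], so the bound [2] suffices. *)
have [ab0|ab0] := eqVneq (a * b) 0.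
  rewrite ab0 invr0 mulr0 sub0r normrN.
  apply: le_trans (norm_damped_kernel_le2 (ltW e0) a0 b0 c0 abc cab) _.
  move/eqP: ab0; rewrite mulf_eq0 => /orP[]/eqP ->;
    by rewrite add0r divff ?gt_eqF//; lra.
have /andP[an0 bn0] : (a != 0) && (b != 0) by move: ab0; rewrite mulf_eq0 negb_or.
have ap : 0 < a by rewrite lt_neqAle eq_sym an0.
have bp : 0 < b by rewrite lt_neqAle eq_sym bn0.
move: abc; rewrite ler_norml => /andP[abc1 abc2].
set N := c ^+ 2 - (a - b) ^+ 2.
have N0 : 0 <= N by rewrite /N; nra.
have N4 : N / (a * b) <= 4 by rewrite ler_pdivrMr ?mulr_gt0// /N; nra.
have q0 : 0 <= N / (a * b) by rewrite divr_ge0// mulr_ge0.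
have -> : (a ^+ 2 + b ^+ 2 - c ^+ 2) / (a * b) - damped_kernel e a b c =
   - (N / (a * b) * (e / (a + e) + e / (b + e) - (e / (a + e)) * (e / (b + e)))).
  by rewrite /damped_kernel /N; field; rewrite an0 bn0 !gt_eqF.
have ta1 : e / (a + e) <= 1 by rewrite ler_pdivrMr//; lra.
have tb1 : e / (b + e) <= 1 by rewrite ler_pdivrMr//; lra.
move: ta tb ta1 tb1 q0 N4.
move: (e / (a + e)) (e / (b + e)) (N / (a * b)) => s t q s0 t0 s1 t1 q0 q4.
have st0 : 0 <= s + t - s * t by nra.
rewrite normrN ger0_norm ?mulr_ge0//.
have : q * (s + t - s * t) <= 4 * (s + t - s * t) by exact: ler_wpM2r.
by nra.
Qed.

Lemma damped_kernelC e a b c : damped_kernel e a b c = damped_kernel e b a c.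
Proof.
rewrite /damped_kernel [in RHS]mulrC -(sqrrN (b - a)) opprB mulrC.
by rewrite [(b + e) * _]mulrC.
Qed.

Lemma damped_kernel_lipschitz e a a' b c c' x : 0 < e ->
  0 <= a -> 0 <= a' -> 0 <= b -> 0 <= c -> 0 <= c' ->
  `|a - b| <= c -> c <= a + b -> `|a' - b| <= c' -> c' <= a' + b ->
  `|a - a'| <= x -> `|c - c'| <= x ->
  `|damped_kernel e a b c - damped_kernel e a' b c'| <= 12 / e * x.
Proof.
move=> e0 a0 a'0 b0 c0 c'0; rewrite !ler_norml.
move=> /andP[h1 h2] h3 /andP[h4 h5] h6 /andP[h7 h8] /andP[h9 h10].
have ae : 0 < a + e by rewrite ltr_wpDl.
have ae' : 0 < a' + e by rewrite ltr_wpDl.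
have be : 0 < b + e by rewrite ltr_wpDl.
(* The damped kernel is [2 - u v] with [u] and [v] in [[0, 2]], each of them
   Lipschitz. *)
pose u := (c + b - a) / (b + e); pose u' := (c' + b - a') / (b + e).
pose v := (c + a - b) / (a + e); pose v' := (c' + a' - b) / (a' + e).
have -> : damped_kernel e a b c - damped_kernel e a' b c' =
    (u' - u) * v' + u * (v' - v).
  by rewrite /damped_kernel /u /u' /v /v'; field; rewrite !gt_eqF.
have x0 : 0 <= x by lra.
pose k := x / e.
have k0 : 0 <= k by rewrite divr_ge0// ltW.
have xk : x = k * e by rewrite /k divfK// gt_eqF.
have u0 : 0 <= u <= 2.
  by rewrite /u divr_ge0 ?(ltW be)//= ?ler_pdivrMr//; lra.
have v'0 : 0 <= v' <= 2.
  by rewrite /v' divr_ge0 ?(ltW ae')//= ?ler_pdivrMr//; lra.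
have du : - (2 * k) <= u' - u <= 2 * k.
  rewrite /u /u' -mulrBl ler_pdivlMr// ler_pdivrMr//.
  by apply/andP; split; nra.
(* The denominator of [v] moves as well; since [v' <= 2], this adds at most a further [2 * x] to the
   numerator. *)
have dv : - (4 * k) <= v' - v <= 4 * k.
  have -> : v' - v = ((c' + a' - b) - (c + a - b) + v' * (a - a')) / (a + e).
    by rewrite /v /v'; field; rewrite !gt_eqF.
  rewrite ler_pdivlMr// ler_pdivrMr//.
  by move/andP : v'0 => [??]; apply/andP; split; nra.
(* [12 = 2 * 2 + 2 * 4], from the two summands of [(u' - u) * v' + u * (v' - v)]. *)
rewrite (_ : 12 / e * x = 12 * k); last by rewrite /k; ring.
move: u0 v'0 du dv => /andP[??] /andP[??] /andP[??] /andP[??].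
by apply/andP; split; nra.
Qed.

End cosine_kernel.

(** * Integrals of bounded functions and dominated convergence *)

Section bounded_integral.
Context {R : realType} {d} {T : measurableType d}.
Implicit Types P : probability T R.

Lemma probability_bounded_integrable P (f : T -> R) (M : R) :
  measurable_fun setT f -> (forall x, `|f x| <= M) ->
  P.-integrable setT (EFin \o f).
Proof.
move=> mf fM; apply: measurable_bounded_integrable => //.
  by rewrite [X in (X < _)%E]probability_setT ltry.
exists M; split; first exact: num_real.
by move=> N MN x _; exact: le_trans (fM x) (ltW MN).
Qed.
Arguments probability_bounded_integrable P {f} M.

(** Dominated convergence with the constant bound [1]; it serves both the remainders of the
    partition of unity and the damping terms. *)
Lemma Rintegral_small P (f : nat -> T -> R) :
  (forall n, measurable_fun setT (f n)) -> (forall n x, 0 <= f n x <= 1) ->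
  {ae P, forall x, f n x @[n --> \oo] --> 0} ->
  forall e : R, 0 < e -> exists n, (\int[P]_x f n x)%R < e.
Proof.
move=> mf f01 f0 e e0.
have fi n : P.-integrable setT (EFin \o f n).
  apply: (probability_bounded_integrable _ 1) => // x.
  by have /andP[? ?] := f01 n x; rewrite ger0_norm.
have [|||||_ _] := @dominated_convergence _ _ _ P setT measurableT
    (fun n => EFin \o f n) (cst 0%E) (cst 1%E).
- by move=> n; exact/measurable_EFinP.
- exact: measurable_cst.
- by apply: filterS f0 => x h _; apply/cvg_EFin; [exact: nearW|exact: h].
- exact: finite_measure_integrable_cst.
- apply: aeW => x n _ /=; rewrite lee_fin.
  by have /andP[? ?] := f01 n x; rewrite ger0_norm.
rewrite integral0 => /fine_cvg/cvgrPdist_lt/(_ e e0)[N _ /(_ N (leqnn N))] /= h.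
exists N; apply: le_lt_trans h.
by rewrite sub0r normrN ler_norm.
Qed.

End bounded_integral.
Arguments probability_bounded_integrable {R d T} P {f} M.

(** * Double integrals of products *)

Section product_integral.
Context {R : realType} {d} {T : measurableType d}.
Variable P : probability T R.

Lemma Rintegral_prod (p q : T -> R) (M N : R) :
  measurable_fun setT p -> measurable_fun setT q ->
  (forall x, `|p x| <= M) -> (forall x, `|q x| <= N) ->
  (\int[(P \x P)%E]_z (p z.1 * q z.2) = \int[P]_x p x * \int[P]_x q x)%R.
Proof.
move=> mp mq pM qN.
have ip := probability_bounded_integrable P _ mp pM.
have iq := probability_bounded_integrable P _ mq qN.
have ipq : (P \x P)%E.-integrable setT (EFin \o (fun z => p z.1 * q z.2)).
  apply: (probability_bounded_integrable _ (M * N)).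
    by apply: measurable_funM; exact: measurableT_comp.
  by move=> z; rewrite normrM ler_pM.
rewrite /Rintegral -(integral12_prod_meas1 ipq) /fubini_F /=.
transitivity (fine (\int[P]_x ((\int[P]_y q y)%R * p x)%:E)%E).
  congr fine; apply: eq_integral => x _.
  rewrite EFinM muleC [X in (_ * X)%E]fineK ?integrable_fin_num//.
  by rewrite -integralZl//; apply: eq_integral => y _; rewrite EFinM.
have := RintegralZl (\int[P]_y q y)%R measurableT ip.
by rewrite /Rintegral => ->; rewrite mulrC.
Qed.

Lemma Rintegral_fst (p : T -> R) (M : R) :
  measurable_fun setT p -> (forall x, `|p x| <= M) ->
  (\int[(P \x P)%E]_z p z.1 = \int[P]_x p x)%R.
Proof.
move=> mp pM.
rewrite -[RHS]mulr1 -[1 in RHS](_ : (\int[P]_x cst 1 x)%R = 1); last first.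
  by rewrite Rintegral_cst// mul1r [X in fine X]probability_setT.
rewrite -(@Rintegral_prod p (cst 1) M 1)//=; last by move=> _; rewrite normr1.
by apply: eq_Rintegral => z _; rewrite mulr1.
Qed.

Lemma Rintegral_snd (p : T -> R) (M : R) :
  measurable_fun setT p -> (forall x, `|p x| <= M) ->
  (\int[(P \x P)%E]_z p z.2 = \int[P]_x p x)%R.
Proof.
move=> mp pM.
rewrite -[RHS]mul1r -[1 in RHS](_ : (\int[P]_x cst 1 x)%R = 1); last first.
  by rewrite Rintegral_cst// mul1r [X in fine X]probability_setT.
rewrite -(@Rintegral_prod (cst 1) p 1 M)//=; last by move=> _; rewrite normr1.
by apply: eq_Rintegral => z _; rewrite mul1r.
Qed.

Lemma Rintegral_sum_prod N (p q : nat -> T -> R) (M M' : nat -> R) :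
  (forall i, measurable_fun setT (p i)) -> (forall i, measurable_fun setT (q i)) ->
  (forall i x, `|p i x| <= M i) -> (forall i x, `|q i x| <= M' i) ->
  (P \x P)%E.-integrable setT (EFin \o (fun z => \sum_(i < N) p i z.1 * q i z.2)) /\
  (\int[(P \x P)%E]_z (\sum_(i < N) p i z.1 * q i z.2) =
   \sum_(i < N) \int[P]_x p i x * \int[P]_x q i x)%R.
Proof.
move=> mp mq pM qM'.
have ipq i : (P \x P)%E.-integrable setT (EFin \o (fun z => p i z.1 * q i z.2)).
  apply: (probability_bounded_integrable _ (M i * M' i)).
    by apply: measurable_funM; exact: measurableT_comp.
  by move=> z; rewrite normrM ler_pM.
elim: N => [|N [iN IH]].
  have E : (fun z : T * T => \sum_(i < 0) p i z.1 * q i z.2) = cst 0.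
    by apply/funext => z; rewrite big_ord0.
  rewrite {}E Rintegral_cst// mul0r big_ord0; split=> //.
  apply: (probability_bounded_integrable _ 0); first exact: measurable_cst.
  by move=> z; rewrite normr0.
have E : (fun z : T * T => \sum_(i < N.+1) p i z.1 * q i z.2) =
   (fun z => (\sum_(i < N) p i z.1 * q i z.2) + p N z.1 * q N z.2).
  by apply/funext => z; rewrite big_ord_recr.
rewrite {}E; split; first exact: (integrableD measurableT iN (ipq N)).
rewrite RintegralD// IH big_ord_recr/=.
by rewrite (Rintegral_prod (mp N) (mq N) (pM N) (qM' N)).
Qed.

End product_integral.

(** * Bounded Lipschitz functions, cutoffs and partitions of unity *)

Definition bounded_lipschitz {R : realType} {T : Type} (dist : T -> T -> R)
    (f : T -> R) :=
  exists K : R, forall x, `|f x| <= K /\ forall y, `|f x - f y| <= K * dist x y.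

Section bounded_lipschitz.
Context {R : realType} {T : Type} (dist : T -> T -> R).
Hypothesis distP : is_metric dist.
Local Notation blip := (bounded_lipschitz dist).

Let dist_ge0 x y : 0 <= dist x y. Proof. by case: distP => + _ _ _; exact. Qed.
Let distC x y : dist x y = dist y x. Proof. by case: distP => _ _ + _; exact. Qed.

Lemma dist_triangle x y z : dist x z <= dist x y + dist y z.
Proof. by case: distP => _ _ _; exact. Qed.

Lemma dist_lipschitz x y z : `|dist x z - dist y z| <= dist x y.
Proof.
have := dist_triangle x y z; have := dist_triangle y x z.
by rewrite (distC y x) ler_norml => ? ?; apply/andP; split; lra.
Qed.

Lemma bounded_lipschitz_cst (c : R) : blip (fun=> c).
Proof.
by exists `|c| => x; split=> // y; rewrite subrr normr0 mulr_ge0.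
Qed.

Lemma bounded_lipschitzD f g : blip f -> blip g -> blip (fun x => f x + g x).
Proof.
move=> [K Kf] [L Lg]; exists (K + L) => x.
have [fK fl] := Kf x; have [gL gl] := Lg x; split=> [|y].
  by apply: le_trans (ler_normD _ _) _; exact: lerD.
rewrite opprD addrACA mulrDl.
by apply: le_trans (ler_normD _ _) _; exact: lerD.
Qed.

Lemma bounded_lipschitzM f g : blip f -> blip g -> blip (fun x => f x * g x).
Proof.
move=> [K Kf] [L Lg]; exists (2 * (K * L)) => x.
have [fK fl] := Kf x; have [gL gl] := Lg x.
have K0 : 0 <= K := le_trans (normr_ge0 _) fK.
have L0 : 0 <= L := le_trans (normr_ge0 _) gL.
have KL0 : 0 <= K * L by exact: mulr_ge0.
split=> [|y].
  rewrite normrM; apply: (@le_trans _ _ (K * L)); last by lra.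
  by rewrite ler_pM.
have [gyL _] := Lg y.
rewrite (_ : _ - _ = f x * (g x - g y) + (f x - f y) * g y); last by ring.
apply: le_trans (ler_normD _ _) _; rewrite !normrM.
apply: (@le_trans _ _ (K * (L * dist x y) + (K * dist x y) * L)); last by lra.
by apply: lerD; rewrite ler_pM.
Qed.

Lemma bounded_lipschitzB f g : blip f -> blip g -> blip (fun x => f x - g x).
Proof.
move=> bf bg.
rewrite (_ : (fun x => _) = (fun x => f x + (-1) * g x)); last first.
  by apply/funext => x; rewrite mulN1r.
apply: bounded_lipschitzD => //; apply: bounded_lipschitzM => //.
exact: bounded_lipschitz_cst.
Qed.

Lemma bounded_lipschitz_prod n (f : nat -> T -> R) :
  (forall i, blip (f i)) -> blip (fun x => \prod_(i < n) f i x).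
Proof.
move=> bf; elim: n => [|n IH].
  rewrite (_ : (fun _ => _) = (fun=> 1)); first exact: bounded_lipschitz_cst.
  by apply/funext => x; rewrite big_ord0.
rewrite (_ : (fun _ => _) = (fun x => (\prod_(i < n) f i x) * f n x)).
  exact: bounded_lipschitzM.
by apply/funext => x; rewrite big_ord_recr.
Qed.

Lemma bounded_lipschitz_damping (e : R) z : 0 < e ->
  blip (fun x => e / (dist x z + e)).
Proof.
(* One constant must bound both the values, at most [1], and the Lipschitz ratio, at most [e^-1];
   their sum does. *)
move=> e0; exists (1 + e^-1) => x.
have ei0 : 0 < e^-1 by rewrite invr_gt0.
have xe : 0 < dist x z + e by rewrite ltr_wpDl.
split=> [|y].
  rewrite ger0_norm; last by rewrite divr_ge0 ?ltW.
  apply: (@le_trans _ _ 1); last by rewrite lerDl ltW.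
  by rewrite ler_pdivrMr// mul1r lerDr.
have ye : 0 < dist y z + e by rewrite ltr_wpDl.
have -> : e / (dist x z + e) - e / (dist y z + e) =
    (dist y z - dist x z) / (dist x z + e) * (e / (dist y z + e)).
  by field; rewrite !gt_eqF.
apply: (@le_trans _ _ (e^-1 * dist x y)); last first.
  by rewrite ler_wpM2r// lerDr.
rewrite normrM -[leRHS]mulr1 ler_pM//.
  rewrite normrM normfV (gtr0_norm xe) mulrC ler_pM//.
    by rewrite invr_ge0 ltW.
  by rewrite lef_pV2 ?posrE// lerDr.
  by rewrite (distC x y); exact: dist_lipschitz.
rewrite ger0_norm; last by rewrite divr_ge0 ?ltW.
by rewrite ler_pdivrMr// mul1r lerDr.
Qed.

(** A Lipschitz cutoff for [r > 0]: [1] at distance less than [r] from [z], [0] at distance [2 * r]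
    or more, affine in the distance between. *)
Definition bump (r : R) z x : R := Num.max 0 (Num.min 1 (2 - dist x z / r)).

Lemma bump_ge0_le1 r z x : 0 <= bump r z x <= 1.
Proof. by rewrite /bump le_max lexx/= ge_max ler01/= ge_min lexx. Qed.

Lemma bump_eq1 r z x : 0 < r -> dist x z < r -> bump r z x = 1.
Proof.
move=> r0 xz; have : dist x z / r < 1 by rewrite ltr_pdivrMr// mul1r.
rewrite /bump => h; rewrite min_l; last by lra.
by rewrite max_r.
Qed.

Lemma bump_neq0 r z x : 0 < r -> bump r z x != 0 -> dist x z < 2 * r.
Proof.
move=> r0; apply: contraNT; rewrite -leNgt -ler_pdivlMr// => h.
apply/eqP; rewrite /bump max_l// ge_min; apply/orP; right; lra.
Qed.

Lemma bounded_lipschitz_bump r z : 0 < r -> blip (bump r z).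
Proof.
move=> r0; exists (1 + r^-1) => x.
have ri0 : 0 < r^-1 by rewrite invr_gt0.
split=> [|y].
  have /andP[b0 b1] := bump_ge0_le1 r z x.
  by rewrite ger0_norm//; apply: le_trans b1 _; rewrite lerDl ltW.
apply: (@le_trans _ _ (r^-1 * dist x y)); last by rewrite ler_wpM2r// lerDr.
have : `|dist x z / r - dist y z / r| <= r^-1 * dist x y.
  rewrite -mulrBl normrM normfV (gtr0_norm r0) mulrC ler_pM2l//.
  exact: dist_lipschitz.
(* Clamping to [0, 1] does not increase distances: each argument lies in one of three affine
   regimes, and the nine pairs are settled separately. *)
have clamp t : let v := Num.max 0 (Num.min 1 t) in
    [\/ t <= 0 /\ v = 0, 0 <= t <= 1 /\ v = t | 1 <= t /\ v = 1 :> R].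
  rewrite /=; have [t1|t1] := leP 1 t; first by apply: Or33; rewrite max_r.
  have [t0|t0] := leP 0 t; last by apply: Or31; rewrite (ltW t0).
  by apply: Or32; rewrite (ltW t1).
rewrite /bump; move: (clamp (2 - dist x z / r)) (clamp (2 - dist y z / r)).
move=> /=; move: (dist x z / r) (dist y z / r) (r^-1 * dist x y) => a b c.
rewrite !ler_norml => + + /andP[h1 h2].
by move=> [[? ->]|[/andP[? ?] ->]|[? ->]] [[? ->]|[/andP[? ?] ->]|[? ->]];
  apply/andP; split; lra.
Qed.

Lemma bounded_lipschitz_continuous f : blip f -> metric_continuous dist f.
Proof.
move=> [K Kf] x e e0.
have K0 : 0 <= K := le_trans (normr_ge0 _) (proj1 (Kf x)).
have K1 : 0 < K + 1 by lra.
exists (e / (K + 1)) => [|y xy]; first exact: divr_gt0.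
apply: le_lt_trans (proj2 (Kf x) y) _.
move: xy; rewrite ltr_pdivlMr// => xy.
by have := dist_ge0 x y; nra.
Qed.

(* The functions [psi i * \prod_(j < i) (1 - psi j)] form a partition of unity,
   up to the remainder [\prod_(j < n) (1 - psi j)]. *)
Lemma partition_remainder (psi : nat -> T -> R) (s : nat -> T)
    (g : T -> T -> R) (e : R) :
  (forall i x, 0 <= psi i x <= 1) ->
  (forall i x y, psi i x != 0 -> `|g x y - g (s i) y| <= e) ->
  forall n x y,
  `|g x y - \sum_(i < n) psi i x * (\prod_(j < i) (1 - psi j x)) * g (s i) y
    - \prod_(j < n) (1 - psi j x) * g x y|
  <= e * (1 - \prod_(j < n) (1 - psi j x)).
Proof.
move=> psi01 gs n x y; pose r m := \prod_(j < m) (1 - psi j x).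
have r0 m : 0 <= r m.
  by apply: prodr_ge0 => i _; have /andP[_] := psi01 i x; rewrite subr_ge0.
elim: n => [|n IH].
  by rewrite !big_ord0 mul1r subr0 !subrr normr0 mulr0.
rewrite big_ord_recr/= -/(r n) -/(r n.+1).
have -> : r n.+1 = r n * (1 - psi n x) by rewrite /r big_ord_recr.
set S := \sum_(i < n) _ in IH *.
(* Step [n] moves the share [psi n x * r n] of the remainder into the sum. The cost is at most [e]
   times this share, exactly the growth of the bound. *)
have -> : g x y - (S + psi n x * r n * g (s n) y) - r n * (1 - psi n x) * g x y
   = (g x y - S - r n * g x y) + (psi n x * r n) * (g x y - g (s n) y) by ring.
have -> : e * (1 - r n * (1 - psi n x)) = e * (1 - r n) + psi n x * r n * e by ring.
apply: le_trans (ler_normD _ _) _; apply: lerD => //.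
have /andP[p0 _] := psi01 n x.
have [->|pn0] := eqVneq (psi n x) 0; first by rewrite !mul0r normr0.
by rewrite normrM ger0_norm ?mulr_ge0// ler_wpM2l ?mulr_ge0//; exact: gs.
Qed.

End bounded_lipschitz.

(** * Weak convergence of double integrals over a separable metric space *)

Section borel_metric.
Context {R : realType} {d} {X : measurableType d} (dist : X -> X -> R).
Hypothesis distP : is_metric dist.
Hypothesis borel : (@measurable d X) = <<s metric_open dist >>.
Local Notation blip := (bounded_lipschitz dist).

Let dist_ge0 x y : 0 <= dist x y. Proof. by case: distP => + _ _ _; exact. Qed.
Let distC x y : dist x y = dist y x. Proof. by case: distP => _ _ + _; exact. Qed.

Lemma metric_continuous_measurable (f : X -> R) :
  metric_continuous dist f -> measurable_fun setT f.
Proof.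
move=> cf; apply: (measurability _ (RGenOInfty.measurableE R)).
move=> _ [_ [a ->] <-]; rewrite setTI preimage_itvoy borel.
apply: sub_sigma_algebra => x /= afx.
have [e e0 xe] := cf x (f x - a) ltac:(by rewrite subr_gt0).
exists e => // y /= /xe; rewrite ltr_norml => /andP[_ h].
by lra.
Qed.

Lemma measurable_metric_dist z : measurable_fun setT (fun x => dist x z).
Proof.
apply: metric_continuous_measurable => x e e0; exists e => // y.
by apply: le_lt_trans; exact: dist_lipschitz.
Qed.

Lemma bounded_lipschitz_measurable f : blip f -> measurable_fun setT f.
Proof.
by move=> bf; exact/metric_continuous_measurable/bounded_lipschitz_continuous.
Qed.

(* Separability makes the metric measurable for the product sigma-algebra,
   through [dist x y = inf_n (dist x (s n) + dist (s n) y)]. *)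
Lemma measurable_dist_pair (s : nat -> X) :
  (forall x (e : R), 0 < e -> exists n, dist x (s n) < e) ->
  measurable_fun setT (fun z : X * X => dist z.1 z.2).
Proof.
move=> sdense; pose h n (z : X * X) := dist z.1 (s n) + dist z.2 (s n).
have h_lb z : has_lbound (range (h ^~ z)).
  by exists 0 => _ [n _ <-]; rewrite addr_ge0.
(* [infs _ 0] is the infimum over the tail from index [0], that is over all [n]. *)
rewrite (_ : (fun _ => _) = (fun z => infs (h ^~ z) 0)).
  apply: measurable_fun_infs => [z _|n]; first exact: h_lb.
  have mdist := measurable_metric_dist (s n).
  exact: (measurable_funD (measurableT_comp mdist measurable_fst)
                          (measurableT_comp mdist measurable_snd)).
apply/funext => z; rewrite /infs /sdrop; apply/eqP; rewrite eq_le; apply/andP; split.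
  apply: lb_le_inf; first by exists (h 0 z), 0.
  move=> _ [n _ <-]; rewrite /h (distC z.2); exact: dist_triangle.
apply/ler_addgt0Pr => e e0.
have [n zn] := sdense z.1 (e / 2) ltac:(by lra).
apply: (@le_trans _ _ (h n z)).
  apply: ge_inf; last by exists n.
  by exists 0 => _ [m _ <-]; rewrite addr_ge0.
have := dist_triangle distP z.2 z.1 (s n).
by rewrite /h (distC z.2 z.1); lra.
Qed.

(* Approximation, up to an error small in mean, by functions for which the
   double integral factors. *)
Definition product_approximable (P : probability X R) (H : X * X -> R) :=
  forall e : R, 0 < e -> exists n (p q : nat -> X -> R) (rho : X -> R),
  [/\ (forall i, blip (p i)) /\ (forall i, blip (q i)), blip rho,
    forall z, `|H z - \sum_(i < n) p i z.1 * q i z.2| <= rho z.1 + rho z.2 &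
    (\int[P]_x rho x)%R < e].

(** The estimate holds for every probability, so it applies to [Pn n] and to the limit with the same
    [p], [q], [rho]. The factor [2] comes from the two marginals of [P \x P]. *)
Lemma Rintegral_product_approx (P : probability X R) (H : X * X -> R) (M : R)
    n (p q : nat -> X -> R) (rho : X -> R) :
  measurable_fun setT H -> (forall z, `|H z| <= M) ->
  (forall i, blip (p i)) -> (forall i, blip (q i)) -> blip rho ->
  (forall z, `|H z - \sum_(i < n) p i z.1 * q i z.2| <= rho z.1 + rho z.2) ->
  `|(\int[(P \x P)%E]_z H z)%R -
     \sum_(i < n) (\int[P]_x p i x)%R * (\int[P]_x q i x)%R|
  <= 2 * (\int[P]_x rho x)%R.
Proof.
move=> mH HM bp bq brho Hpq.
have mp i := bounded_lipschitz_measurable (bp i).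
have mq i := bounded_lipschitz_measurable (bq i).
have mrho := bounded_lipschitz_measurable brho.
have [K pK] := choice bp; have [L qL] := choice bq; have [N rhoN] := brho.
have [isum <-] := Rintegral_sum_prod P n mp mq (fun i x => proj1 (pK i x))
  (fun i x => proj1 (qL i x)).
have iH := probability_bounded_integrable (P \x P)%E _ mH HM.
have irho1 : (P \x P)%E.-integrable setT (EFin \o (fun z => rho z.1)).
  apply: (probability_bounded_integrable _ N); first exact: measurableT_comp.
  by move=> z; have [] := rhoN z.1.
have irho2 : (P \x P)%E.-integrable setT (EFin \o (fun z => rho z.2)).
  apply: (probability_bounded_integrable _ N); first exact: measurableT_comp.
  by move=> z; have [] := rhoN z.2.
have idiff := integrableB measurableT iH isum.
rewrite -RintegralB//.
apply: le_trans (le_normr_Rintegral measurableT idiff) _.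
rewrite mulr2n mulrDl mul1r.
rewrite -[X in X + _](Rintegral_fst P mrho (fun x => proj1 (rhoN x))).
rewrite -[X in _ + X](Rintegral_snd P mrho (fun x => proj1 (rhoN x))).
rewrite -RintegralD//; apply: le_Rintegral => //.
- exact: (integrable_norm idiff).
- exact: (integrableD measurableT irho1 irho2).
Qed.

Lemma weak_cvg_Rintegral (Pn : nat -> probability X R) (P : probability X R) f :
  weak_cvg dist Pn P -> blip f ->
  (\int[Pn n]_x f x)%R @[n --> \oo] --> (\int[P]_x f x)%R.
Proof.
move=> PnP bf; have [K fK] := bf.
have fi := probability_bounded_integrable P _ (bounded_lipschitz_measurable bf)
  (fun x => proj1 (fK x)).
apply: fine_cvg; rewrite fineK ?integrable_fin_num//.
apply: PnP; first exact: bounded_lipschitz_continuous.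
by exists K => x; have [] := fK x.
Qed.

(** The approximation is chosen for the limit [P] alone. Since [rho] is bounded Lipschitz, its mean
    under [Pn n] tends to its mean under [P], so the same approximation is good for large [n]. *)
Lemma weak_cvg_product (Pn : nat -> probability X R) (P : probability X R)
    (H : X * X -> R) (M : R) :
  weak_cvg dist Pn P -> measurable_fun setT H -> (forall z, `|H z| <= M) ->
  product_approximable P H ->
  (\int[(Pn n \x Pn n)%E]_z H z)%R @[n --> \oo] --> (\int[(P \x P)%E]_z H z)%R.
Proof.
move=> PnP mH HM appH; apply/cvgrPdist_lt => e e0.
(* The error is at most [2 * (e / 8)] under [P], [2 * (e / 8 + e / 8)] under [Pn n] and [e / 8]
   between the sums: [7 * e / 8] in total. *)
have [N [p [q [rho [[bp bq] brho Hpq rhoe]]]]] := appH (e / 8) ltac:(by lra).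
have cS : (\sum_(i < N) (\int[Pn n]_x p i x)%R * (\int[Pn n]_x q i x)%R)
    @[n --> \oo] --> \sum_(i < N) (\int[P]_x p i x)%R * (\int[P]_x q i x)%R.
  elim: N {Hpq} => [|N IH].
    by rewrite big_ord0; under eq_fun do rewrite big_ord0; exact: cvg_cst.
  rewrite big_ord_recr/=; under eq_fun do rewrite big_ord_recr/=.
  apply: cvgD => //; apply: cvgM; exact: weak_cvg_Rintegral.
have crho := weak_cvg_Rintegral PnP brho.
have e8 : 0 < e / 8 by lra.
move/cvgrPdist_lt/(_ _ e8) : cS => cS.
move/cvgrPdist_lt/(_ _ e8) : crho => crho.
near=> n.
have := Rintegral_product_approx P mH HM bp bq brho Hpq.
have := Rintegral_product_approx (Pn n) mH HM bp bq brho Hpq.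
have : `|\sum_(i < N) (\int[P]_x p i x)%R * (\int[P]_x q i x)%R -
  \sum_(i < N) (\int[Pn n]_x p i x)%R * (\int[Pn n]_x q i x)%R| < e / 8.
  by near: n.
have : `|(\int[P]_x rho x)%R - (\int[Pn n]_x rho x)%R| < e / 8 by near: n.
rewrite !ler_norml !ltr_norml.
move=> /andP[? ?] /andP[? ?] /andP[? ?] /andP[? ?].
by apply/andP; split; lra.
Unshelve. all: by end_near. Qed.

(** Only the first variable is discretised. Finitely many small balls need not cover the space;
    dominated convergence makes the uncovered remainder small in mean instead. *)
Lemma lipschitz_product_approximable (P : probability X R) (s : nat -> X)
    (g : X -> X -> R) (M L : R) :
  (forall x (e : R), 0 < e -> exists n, dist x (s n) < e) ->
  0 < M -> 0 < L -> (forall x y, `|g x y| <= M) ->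
  (forall x x' y, `|g x y - g x' y| <= L * dist x x') ->
  (forall x y y', `|g x y - g x y'| <= L * dist y y') ->
  product_approximable P (fun z => g z.1 z.2).
Proof.
move=> sdense M0 L0 gM gl gr e e0.
(* The bumps live on balls of radius [2 * r], on which [g] differs from its value at the centre by
   at most [L * (2 * r) = e / 4]. *)
pose r := e / (8 * L).
have r0 : 0 < r by rewrite divr_gt0// mulr_gt0.
pose psi i := bump dist r (s i).
have psi01 i x : 0 <= psi i x <= 1 by exact: bump_ge0_le1.
have gs i x y : psi i x != 0 -> `|g x y - g (s i) y| <= e / 4.
  move=> /(bump_neq0 r0) xs; apply: le_trans (gl _ _ _) _.
  apply: (@le_trans _ _ (L * (2 * r))); first by rewrite ler_pM2l// ltW.
  by rewrite le_eqVlt; apply/orP; left; apply/eqP; rewrite /r; field; rewrite gt_eqF.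
have bpsi i : blip (psi i) by exact: bounded_lipschitz_bump.
pose rem n x := \prod_(j < n) (1 - psi j x).
have brem n : blip (rem n).
  apply: (@bounded_lipschitz_prod _ _ _ distP n (fun j x => 1 - psi j x)).
  move=> j; apply: bounded_lipschitzB; [by []| |exact: bpsi].
  exact: bounded_lipschitz_cst.
have rem01 n x : 0 <= rem n x <= 1.
  rewrite /rem prodr_ge0 => [|i _]; last first.
    by have /andP[_] := psi01 i x; rewrite subr_ge0.
  apply: prodr_ile1 => i _; have /andP[h1 h2] := psi01 i x.
  by rewrite subr_ge0 h2/= lerBlDr lerDl.
(* Some [s k] is within [r] of [x]; for [n > k] the product has the factor [1 - psi k x = 0]. *)
have rem_cvg x : rem n x @[n --> \oo] --> 0.
  have [k xk] := sdense x r r0.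
  apply: cvg_near_cst; exists k.+1 => // n /= kn.
  by rewrite /rem (bigD1 (Ordinal kn))//= /psi bump_eq1// subrr mul0r.
have eM : 0 < e / (2 * M) by rewrite divr_gt0// mulr_gt0.
have [n remn] := Rintegral_small
  (fun n => bounded_lipschitz_measurable (brem n)) rem01 (aeW P rem_cvg) eM.
(* The mean of [rho] will be below [e / 4 + M * (e / (2 * M)) = 3 * e / 4]. *)
exists n, (fun i x => psi i x * rem i x), (fun i y => g (s i) y),
  (fun x => e / 4 + M * rem n x); split.
- split=> i; first exact: bounded_lipschitzM.
  exists (L + M) => y; split; first by apply: le_trans (gM _ _) _; rewrite lerDr ltW.
  by move=> y'; apply: le_trans (gr _ _ _) _; rewrite ler_wpM2r// lerDl ltW.
- apply: bounded_lipschitzD; first exact: bounded_lipschitz_cst.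
  by apply: bounded_lipschitzM => //; exact: bounded_lipschitz_cst.
- move=> z; have := partition_remainder psi01 gs n z.1 z.2.
  rewrite -/(rem n z.1); have := gM z.1 z.2.
  set S := \sum_(i < n) _; move: (rem01 n z.1) (rem01 n z.2).
  move: (rem n z.1) (rem n z.2) (g z.1 z.2) S => a b c S.
  move=> /andP[a0 a1] /andP[b0 b1].
  rewrite !ler_norml => /andP[c1 c2] /andP[h1 h2].
  by apply/andP; split; nra.
- have irem : P.-integrable setT (EFin \o rem n).
    apply: (probability_bounded_integrable _ 1).
      exact: bounded_lipschitz_measurable.
    by move=> x; have /andP[? ?] := rem01 n x; rewrite ger0_norm.
  rewrite RintegralD//; last 2 first.
  + exact: finite_measure_integrable_cst.
  + apply: (probability_bounded_integrable _ M).
      exact: (measurable_funM (measurable_cst _)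
                (bounded_lipschitz_measurable (brem n))).
    move=> x; have /andP[? ?] := rem01 n x.
    rewrite ger0_norm; last by rewrite mulr_ge0// ltW.
    by rewrite ler_piMr// ltW.
  rewrite Rintegral_cst// RintegralZl// [X in fine X]probability_setT mulr1.
  move: remn; rewrite ltr_pdivlMr ?mulr_gt0// => remn.
  by lra.
Qed.

End borel_metric.

(** * The kernel of the spatial depth *)

Section spatial_depth.
Context {R : realType} {d} {X : measurableType d} (dist : X -> X -> R).
Hypothesis distP : is_metric dist.
Hypothesis borel : (@measurable d X) = <<s metric_open dist >>.
Variables (mu : X) (s : nat -> X).
Hypothesis sdense : forall x (e : R), 0 < e -> exists n, dist x (s n) < e.

Let dist_ge0 x y : 0 <= dist x y. Proof. by case: distP => + _ _ _; exact. Qed.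
Let distC x y : dist x y = dist y x. Proof. by case: distP => _ _ + _; exact. Qed.
Let dist_eq0 x y : dist x y = 0 <-> x = y.
Proof. by case: distP => _ + _ _; exact. Qed.
Let dist_triangle_mu x y : dist x y <= dist x mu + dist y mu.
Proof. by rewrite (distC y); exact: dist_triangle. Qed.

(* The indicator in [hker] is absorbed by the convention [x / 0 = 0]. *)
Lemma hkerE x y : hker dist x y mu =
  (dist x mu ^+ 2 + dist y mu ^+ 2 - dist x y ^+ 2) / (dist x mu * dist y mu).
Proof.
rewrite /hker; case: ifPn => // /orP[]/eqP <-.
  by rewrite (proj2 (dist_eq0 mu mu) erefl) mul0r invr0 mulr0.
by rewrite (proj2 (dist_eq0 mu mu) erefl) mulr0 invr0 mulr0.
Qed.

Lemma measurable_hker :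
  measurable_fun setT (fun z : X * X => hker dist z.1 z.2 mu).
Proof.
have ma := measurableT_comp (measurable_metric_dist distP borel mu)
  (@measurable_fst _ _ X X).
have mb := measurableT_comp (measurable_metric_dist distP borel mu)
  (@measurable_snd _ _ X X).
have mc := measurable_dist_pair distP borel sdense.
have minv : measurable_fun setT (@GRing.inv R).
  rewrite -(setUv [set 0]); apply/measurable_funU => //.
    exact: measurableC.
  split; first exact: measurable_fun_set1.
  apply: open_continuous_measurable_fun.
    by apply: closed_openC; exact: closed_eq.
  by move=> x; rewrite inE /= => /eqP x0; exact: inv_continuous.
under eq_fun do rewrite hkerE.
apply: measurable_funM.
  apply: measurable_funB; last exact: (measurable_funX 2 mc).
  exact: (measurable_funD (measurable_funX 2 ma) (measurable_funX 2 mb)).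
exact: (measurableT_comp minv (measurable_funM ma mb)).
Qed.

Lemma hker_damped_kernel e x y : 0 < e ->
  `|hker dist x y mu - damped_kernel e (dist x mu) (dist y mu) (dist x y)|
  <= 4 * (e / (dist x mu + e)) + 4 * (e / (dist y mu + e)).
Proof.
by move=> e0; rewrite hkerE; apply: damped_kernel_approx => //;
  exact: dist_lipschitz.
Qed.

(** Where [mu] differs from both points this is the damped bound at [e = 0]; elsewhere the kernel is
    [0]. *)
Lemma norm_hker_le2 x y : `|hker dist x y mu| <= 2.
Proof.
have := @norm_damped_kernel_le2 R 0 (dist x mu) (dist y mu) (dist x y).
move=> /(_ (lexx 0) (dist_ge0 _ _) (dist_ge0 _ _) (dist_ge0 _ _)
  (dist_lipschitz distP _ _ _) (dist_triangle_mu _ _)).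
have [ab0|ab0] := eqVneq (dist x mu * dist y mu) 0.
  by rewrite hkerE ab0 invr0 mulr0 normr0.
rewrite hkerE /damped_kernel !addr0 (_ : 2 - _ = (dist x mu ^+ 2 + dist y mu ^+ 2 -
   dist x y ^+ 2) / (dist x mu * dist y mu))//.
by move: ab0; rewrite mulf_eq0 negb_or => /andP[? ?]; field; apply/andP.
Qed.

(** At [mu] itself the damping term is constantly [1], so almost sure convergence to [0] amounts to
    [mu] not being an atom. *)
Lemma damping_cvg0 x : x <> mu ->
  n.+1%:R^-1 / (dist x mu + n.+1%:R^-1) @[n --> \oo] --> (0 : R).
Proof.
move=> xmu; have x0 : 0 < dist x mu.
  by rewrite lt_neqAle dist_ge0 andbT eq_sym; apply/eqP => /dist_eq0.
apply: (squeeze_cvgr (f := cst 0) (h := fun n => n.+1%:R^-1 * (dist x mu)^-1)).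
- apply: nearW => n; have n0 : 0 < n.+1%:R^-1 :> R by rewrite invr_gt0.
  rewrite divr_ge0 ?addr_ge0 ?(ltW n0)//= ler_pM2l// lef_pV2 ?posrE ?addr_gt0//.
  by rewrite lerDl ltW.
- exact: cvg_cst.
- rewrite -[X in _ --> X](mul0r (dist x mu)^-1).
  by apply: cvgM; [exact: cvg_harmonic|exact: cvg_cst].
Qed.

Lemma hker_product_approximable (P : probability X R) :
  P [set mu] = 0%E ->
  product_approximable dist P (fun z => hker dist z.1 z.2 mu).
Proof.
move=> Pmu e e0.
pose tau n x : R := n.+1%:R^-1 / (dist x mu + n.+1%:R^-1).
have n0 n : 0 < n.+1%:R^-1 :> R by rewrite invr_gt0.
have btau n : bounded_lipschitz dist (tau n) by exact: bounded_lipschitz_damping.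
have mtau n := bounded_lipschitz_measurable distP borel (btau n).
have tau01 n x : 0 <= tau n x <= 1.
  rewrite /tau divr_ge0 ?addr_ge0 ?(ltW (n0 n))//=.
  by rewrite ler_pdivrMr ?mul1r ?lerDr// ltr_wpDl.
have mmu : measurable [set mu].
  rewrite -[X in measurable X]setCK; apply: measurableC.
  rewrite borel; apply: sub_sigma_algebra => x /= xmu.
  exists (dist x mu); last by move=> y /= xy ymu; move: xy; rewrite ymu ltxx.
  by rewrite lt_neqAle dist_ge0 andbT eq_sym; apply/eqP => /dist_eq0.
have tau0 : {ae P, forall x, tau n x @[n --> \oo] --> 0}.
  exists [set mu]; split=> // x /= xtau; apply: contrapT => xmu.
  by apply: xtau; exact: damping_cvg0.
(* The damping error enters [rho] with factor [4]: it receives [4 * (e / 8) = e / 2], and the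
   product approximation the other [e / 2]. *)
have e8 : 0 < e / 8 by lra.
have [n taun] := Rintegral_small mtau tau01 tau0 e8.
pose g x y := damped_kernel n.+1%:R^-1 (dist x mu) (dist y mu) (dist x y).
have g2 x y : `|g x y| <= 2.
  by apply: norm_damped_kernel_le2 => //; exact: dist_lipschitz.
have gl x x' y : `|g x y - g x' y| <= 12 / n.+1%:R^-1 * dist x x'.
  apply: damped_kernel_lipschitz => //; exact: dist_lipschitz.
have gC x y : g x y = g y x by rewrite /g damped_kernelC (distC x y).
have gr x y y' : `|g x y - g x y'| <= 12 / n.+1%:R^-1 * dist y y'.
  by rewrite !(gC x).
have L0 : 0 < 12 / n.+1%:R^-1 :> R by rewrite divr_gt0.
have e2 : 0 < e / 2 by lra.
have [N [p [q [rho [[bp bq] brho gpq rhoe]]]]] :=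
  lipschitz_product_approximable distP borel P sdense (ltr0n R 2) L0 g2 gl gr e2.
have bt : bounded_lipschitz dist (fun x => 4 * tau n x).
  by apply: bounded_lipschitzM => //; exact: bounded_lipschitz_cst.
exists N, p, q, (fun x => 4 * tau n x + rho x); split=> //.
- exact: bounded_lipschitzD.
- move=> z; have := gpq z; have := hker_damped_kernel z.1 z.2 (n0 n).
  rewrite -/(g z.1 z.2) -/(tau n z.1) -/(tau n z.2).
  rewrite !ler_norml => /andP[? ?] /andP[? ?].
  by apply/andP; split; lra.
- have itau := probability_bounded_integrable P 1 (mtau n)
    (fun x => ltac:(by have /andP[? ?] := tau01 n x; rewrite ger0_norm)).
  have [K rhoK] := brho; have [K' tK] := bt.
  have irho := probability_bounded_integrable P _
    (bounded_lipschitz_measurable distP borel brho) (fun x => proj1 (rhoK x)).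
  have it := probability_bounded_integrable P _
    (bounded_lipschitz_measurable distP borel bt) (fun x => proj1 (tK x)).
  by rewrite RintegralD// RintegralZl//; lra.
Qed.

(** The kernel is bounded and measurable, so the integral is finite and convergence can be proved
    among real numbers. *)
Lemma msdepthE (P : probability X R) : msdepth dist P mu =
  (1 - 2^-1 * \int[(P \x P)%E]_z hker dist z.1 z.2 mu)%R%:E.
Proof.
have ih := probability_bounded_integrable (P \x P)%E _ measurable_hker
  (fun z => norm_hker_le2 z.1 z.2).
by rewrite /msdepth EFinB EFinM fineK//; exact: integrable_fin_num.
Qed.

End spatial_depth.

Theorem theorem5 (R : realType) (d : measure_display) (X : measurableType d)
  (dist : X -> X -> R)
  (hmetric : is_metric dist)
  (hcomplete : metric_complete dist)
  (hseparable : metric_separable dist)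
  (hborel : (@measurable d X) = <<s metric_open dist >>)
  (mu : X) (PX : probability X R) (Pn : nat -> probability X R)
  (hatom : PX [set mu] = 0%E)
  (hweak : weak_cvg dist Pn PX) :
  (fun n => msdepth dist (Pn n) mu) @ \oo --> msdepth dist PX mu.
Proof.
(* Countability gives a sequence [s] whose range contains the dense set, so [s] is dense too. *)
have [S [/pcard_surjP[s sS] Sdense]] := hseparable.
have sdense x (e : R) : 0 < e -> exists n, dist x (s n) < e.
  move=> /(Sdense x)[y Sy xy]; have [n _ sn] := sS _ Sy.
  by exists n; rewrite sn.
rewrite (msdepthE hmetric hborel mu sdense).
under eq_fun do rewrite (msdepthE hmetric hborel mu sdense).
apply: cvg_EFin; first exact: nearW.
apply: cvgB; first exact: cvg_cst.
apply: cvgM; first exact: cvg_cst.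
apply: (@weak_cvg_product _ _ _ _ hmetric hborel Pn PX
  (fun z => hker dist z.1 z.2 mu) 2) => //.
- exact: (measurable_hker hmetric hborel mu sdense).
- by move=> z; exact: norm_hker_le2.
- exact: (hker_product_approximable hmetric hborel sdense hatom).
Qed.
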